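(* Let $I,J\subset\mathbb{N}$ be disjoint infinite sets with $I\cup J=\mathbb{N}$. For each $j\in J$ fix a function $\varphi_j:\{0,\dots,p-1\}^j\to\{0,\dots,p-1\}$. For $\gamma\ge0$ define $$C_\gamma=\Big\{\sum_{i=0}^{\gamma-1}t_ip^i:\ t_i\in\{0,\dots,p-1\},\ t_j=\varphi_j(t_0,\dots,t_{j-1})\text{ for all }j\in J,\ j<\gamma\Big\}\subset\mathbb{Z}_p$$ and $\Omega_\gamma=\bigsqcup_{c\in C_\gamma}(c+p^\gamma\mathbb{Z}_p)$. Then $\Omega_0\supset\Omega_1\supset\cdots$. The probability measures $\mathfrak{m}|_{\Omega_\gamma}/\mathfrak{m}(\Omega_\gamma)$ converge weakly to a probability measure $\mu_{I,J}$, which is singular with respect to $\mathfrak{m}$. Moreover, $\mu_{I,J}$ is a spectral measure with spectrum $$\Lambda=\Big\{\sum_{i\in I}b_ip^{-i-1}:\ b_i\in\{0,\dots,p-1\},\ \text{only finitely many }b_i\neq0\Big\}.$$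
   Context: $p\ge2$ is a prime and $\mathbb{N}=\{0,1,2,\dots\}$. $\mathbb{Q}_p$ and $\mathbb{Z}_p$ are the $p$-adic numbers and $p$-adic integers, with valuation $v_p$. $\mathfrak{m}$ is the Haar measure on $\mathbb{Q}_p$ with $\mathfrak{m}(\mathbb{Z}_p)=1$. Characters: $\chi(x)=e^{2\pi i\{x\}}$, where $\{x\}=\sum_{n=v_p(x)}^{-1}a_np^n$ is the fractional part of $x=\sum_{n\ge v_p(x)}a_np^n$ with digits $a_n\in\{0,\dots,p-1\}$. Also $\chi_y(x)=\chi(yx)$. Spectral measure: a Borel probability measure $\mu$ is spectral with spectrum $\Lambda$ if $\{\chi_\lambda\}_{\lambda\in\Lambda}$ is an orthonormal basis of $L^2(\mu)$. *)

(* Defs.v *)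
From HB Require Import structures.
From mathcomp Require Import all_boot all_order all_algebra.
From mathcomp Require Import all_classical all_reals all_analysis.
Set Implicit Arguments. Unset Strict Implicit. Unset Printing Implicit Defensive.
Import Order.TTheory GRing.Theory Num.Theory.
Import numFieldNormedType.Exports.
Local Open Scope classical_set_scope.
Local Open Scope ring_scope.

(* A p-adic digit in {0,...,p-1}.  We write 'I_p.-1.+1 (which is 'I_p for
   p >= 1, in particular for p prime) so that the type is inhabited. *)
Definition digit (p : nat) := 'I_p.-1.+1.

(* Z_p is modelled by its digit expansions x = sum_{n>=0} x_n p^n. *)
Definition Zp_dig (p : nat) := nat -> digit p.
HB.instance Definition _ (p : nat) := Choice.copy (Zp_dig p) (nat -> digit p).
HB.instance Definition _ (p : nat) :=
  isPointed.Build (Zp_dig p) (fun _ => ord0).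

(* zval n x = x_0 + x_1 p + ... + x_{n-1} p^{n-1} = (x mod p^n) as a natural. *)
Definition zval (p n : nat) (x : Zp_dig p) : nat :=
  (\sum_(k < n) x k * p ^ k)%N.

(* the ball x + p^n Z_p *)
Definition cylinder (p n : nat) (x : Zp_dig p) : set (Zp_dig p) :=
  [set y | forall i, (i < n)%N -> y i = x i].

(* open sets of Z_p (p-adic topology = product topology of discrete digits) *)
Definition zp_open (p : nat) (A : set (Zp_dig p)) : Prop :=
  forall x, A x -> exists n, cylinder n x `<=` A.

Notation Zpadic p := (g_sigma_algebraType (@zp_open p)).

(* p-adic addition: the n-th digit of x + y is read off
   (x + y) mod p^(n+1) = (zval (n+1) x + zval (n+1) y) mod p^(n+1). *)
Definition zp_add (p : nat) (x y : Zp_dig p) : Zp_dig p :=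
  fun i => inord (((zval i.+1 x + zval i.+1 y) %% p ^ i.+1) %/ p ^ i)%N.

Definition zp_continuous (R : realType) (p : nat) (f : Zp_dig p -> R) : Prop :=
  forall U : set R, open U -> zp_open (f @^-1` U).

Definition C_set (p : nat) (J : set nat)
  (phi : forall j : nat, {ffun 'I_j -> digit p} -> digit p) (g : nat) : set nat :=
  [set c | exists t : Zp_dig p,
     (forall j, J j -> (j < g)%N -> t j = phi j [ffun i : 'I_j => t i]) /\
     c = zval g t].

(* Omega_gamma = union_{c in C_gamma} (c + p^gamma Z_p); x lies in
   c + p^gamma Z_p (with 0 <= c < p^gamma) iff x mod p^gamma = c. *)
Definition Omega (p : nat) (J : set nat)
  (phi : forall j : nat, {ffun 'I_j -> digit p} -> digit p) (g : nat)
  : set (Zpadic p) :=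
  [set x | exists2 c, C_set J phi g c & zval g x = c].

(* The candidate spectrum, as a set of rationals (Q is a subset of Q_p) *)
Definition Lambda (p : nat) (I : set nat) : set rat :=
  [set q | exists (b : nat -> nat) (N : nat),
     (forall i, (b i < p)%N) /\
     (forall i, b i != 0%N -> I i /\ (i < N)%N) /\
     q = \sum_(i < N) (b i)%:R / (p%:R ^+ i.+1)].

(* Fractional part {q x} for q in Z[1/p] (denq q = p^N) and x in Z_p:
   q x = numq q * x / p^N and x = zval N x mod p^N Z_p, hence
   {q x} = ((numq q * zval N x) mod p^N) / p^N.
   chi_q(x) = exp(2 pi i {q x}). *)
Definition phase (R : realType) (p : nat) (q : rat) (x : Zp_dig p) : R :=
  ((numq q * (zval (logn p `|denq q|%N) x)%:Z) %% denq q)%Z%:~R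
  / (denq q)%:~R.

(* Main.v *)
Require Import Defs.
From HB Require Import structures.
From mathcomp Require Import all_boot all_order all_algebra.
From mathcomp Require Import all_classical all_reals all_analysis.
From mathcomp Require Import complex measurable_realfun zify ring lra.
Set Implicit Arguments. Unset Strict Implicit. Unset Printing Implicit Defensive.
Import Order.TTheory GRing.Theory Num.Theory.
Import numFieldNormedType.Exports.
Local Open Scope classical_set_scope.
Local Open Scope ring_scope.

(** Let [fill] keep the digits of index in [I] and recompute, in increasing
    order, each digit of index [j] in [J] as the value of [phi j] on the
    preceding ones.  The limit measure is the law [mu] of [fill] under Haar
    measure.  Among the [p ^ n] words of length [n], exactly [p ^ num_forced n]
    are sent by [fill] to a given word of [Omega n], and none to another word;
    hence [mu] agrees on balls of radius [p ^- n] with Haar measure conditioned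
    on [Omega n], and uniform continuity gives the weak convergence.  Since
    [mu] lives on every [Omega n] while [m (Omega n) = p ^- num_forced n], the
    two measures are mutually singular.

    A frequency of level [n] is [a / p ^ n], where [a] is the value of the
    reversed word of its coefficients, so characters of level [n] are the
    [e (a x / p ^ n)] and the roles of [a] and [x] are symmetric.  If [y] and
    [z] first differ at digit [j], and [x] runs over a set of words that is
    stable under incrementing digit [i = n - 1 - j], the sum of
    [e ((y - z) x / p ^ n)] vanishes: incrementing that digit multiplies it by
    a nontrivial [p]-th root of unity.  Taking frequencies for [y], [z] and
    points for [x] gives orthogonality.  Taking points for [y], [z] and
    frequencies for [x] gives an inversion formula on words: two points of the
    support first differ at an index of [I], where the coefficient of a
    frequency is free.  A function orthogonal to all characters therefore has
    integral [0] on every ball. *)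

Lemma Re_sum (F : rcfType) (T : finType) (f : T -> F[i]) :
  complex.Re (\sum_t f t) = \sum_t complex.Re (f t).
Proof. exact: (raddf_sum (@complex.Re F : Rcomplex F -> F)). Qed.

Lemma Im_sum (F : rcfType) (T : finType) (f : T -> F[i]) :
  complex.Im (\sum_t f t) = \sum_t complex.Im (f t).
Proof. exact: (raddf_sum (@complex.Im F : Rcomplex F -> F)). Qed.

Section AdditiveCharacter.
Variable R : realType.
Implicit Types (x y : R) (a b c : int) (M N : nat).

Definition expi2pi x : R[i] := (cos (2 * pi * x) +i* sin (2 * pi * x))%C.

Lemma expi2pi0 : expi2pi 0 = 1.
Proof. by rewrite /expi2pi mulr0 cos0 sin0. Qed.

Lemma expi2piD x y : expi2pi (x + y) = expi2pi x * expi2pi y.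
Proof.
rewrite /expi2pi mulrDr cosD sinD; congr Complex.
by rewrite addrC [X in X + _]mulrC.
Qed.

Lemma expi2piN x : expi2pi (- x) = (expi2pi x)^*%C.
Proof. by rewrite /expi2pi mulrN cosN sinN. Qed.

Lemma expi2pi_nat n : expi2pi n%:R = 1.
Proof.
elim: n => [|n ih]; first exact: expi2pi0.
by rewrite -natr1 expi2piD ih mul1r /expi2pi mulr1 mulr_natl cos2pi sin2pi.
Qed.

Lemma expi2pi_int a : expi2pi a%:~R = 1.
Proof.
case: a => n; first exact: expi2pi_nat.
rewrite NegzE mulrNz -pmulrn -[LHS]mulr1 -[X in _ * X](expi2pi_nat n.+1).
by rewrite -expi2piD addNr expi2pi0.
Qed.

Lemma expi2pi_neq1 x : 0 < x < 1 -> expi2pi x != 1.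
Proof.
move=> /andP[x0 x1]; have pi0 := pi_gt0 R.
have sin_gt0 : 0 < sin (pi * x).
  by rewrite sin_gt0_pi// mulr_gt0//= -[ltRHS]mulr1 ltr_pM2l.
apply/eqP => -[+ _]; rewrite -mulrA mulr_natl cos_mulr2n cos2sin2 => /eqP.
by rewrite lt_eqF// -mulr_natr; have := exprn_gt0 2 sin_gt0; lra.
Qed.

Definition echar N a : R[i] := expi2pi (a%:~R / N%:R).

Lemma echar0 N : echar N 0 = 1.
Proof. by rewrite /echar mul0r expi2pi0. Qed.

Lemma echarD N a b : echar N (a + b) = echar N a * echar N b.
Proof. by rewrite /echar intrD mulrDl expi2piD. Qed.

Lemma echarN N a : echar N (- a) = (echar N a)^*%C.
Proof. by rewrite /echar intrN mulNr expi2piN. Qed.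

Lemma echar_mod N a : (0 < N)%N -> echar N (a %% N%:Z)%Z = echar N a.
Proof.
move=> N0; have NR0 : N%:R != 0 :> R by rewrite pnatr_eq0 -lt0n.
rewrite [in RHS](divz_eq a N%:Z) [RHS]echarD [X in X * _]/echar.
by rewrite intrM -pmulrn mulfK// expi2pi_int mul1r.
Qed.

Lemma echar_scale N M a :
  (0 < M)%N -> echar (N * M) (a * M%:Z) = echar N a.
Proof.
move=> M0; rewrite /echar intrM -pmulrn natrM -mulf_div divff ?mulr1//.
by rewrite pnatr_eq0 -lt0n.
Qed.

Lemma eq_echar N a b :
  (0 < N)%N -> (a = b %[mod N%:Z])%Z -> echar N a = echar N b.
Proof. by move=> N0 ab; rewrite -echar_mod// ab echar_mod. Qed.

Lemma echar_eq1 N a : (0 < N)%N -> (echar N a == 1) = (N%:Z %| a)%Z.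
Proof.
move=> N0; rewrite -echar_mod//.
case: dvdz_mod0P => [->|/eqP r0]; first by rewrite echar0 eqxx.
apply/negbTE/expi2pi_neq1.
rewrite divr_gt0 ?ltr0n// ?ltr0z ?lt0r ?r0 ?modz_ge0//=.
  by rewrite ltr_pdivrMr ?ltr0n// mul1r pmulrn ltr_int ltz_pmod.
by rewrite -lt0n.
Qed.

Lemma sum_echar_shift (T : finType) (f : T -> int) (tau : T -> T) c N :
  (0 < N)%N -> injective tau ->
  (forall t, (f (tau t) = f t + c %[mod N%:Z])%Z) -> ~~ (N%:Z %| c)%Z ->
  \sum_t echar N (f t) = 0.
Proof.
move=> N0 tauI ftau Nc; set S := \sum_t _.
have SE : S = S * echar N c.
  rewrite {1}/S (reindex_inj tauI) mulr_suml; apply: eq_bigr => t _.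
  by rewrite (eq_echar N0 (ftau t)) echarD.
have : S * (1 - echar N c) = 0 by rewrite mulrBr mulr1 -SE subrr.
move/eqP; rewrite mulf_eq0 subr_eq0 [1 == _]eq_sym echar_eq1//.
by rewrite (negbTE Nc) orbF => /eqP.
Qed.

End AdditiveCharacter.

Section FiniteValued.
Context d (X : measurableType d) (R : realType) (K : finType).
Variables (nu : {measure set X -> \bar R}) (h : X -> K).
Hypothesis mh : forall k, measurable (h @^-1` [set k]).

Lemma measurable_preimage_finite (A : set K) : measurable (h @^-1` A).
Proof.
rewrite (_ : _ @^-1` _ = \bigcup_(k in A) h @^-1` [set k]).
  by apply: fin_bigcup_measurable => //; exact: finite_finset.
by apply/seteqP; split=> [x Ax|x [k Ak /= ->]] //; exists (h x).
Qed.

Lemma measurable_fun_comp_finite d' (Y : measurableType d') (g : K -> Y)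
  (D : set X) : measurable_fun D (fun x => g (h x)).
Proof.
move=> mD A mA; apply: measurableI => //.
exact: (measurable_preimage_finite (g @^-1` A)).
Qed.

Lemma integral_finite_partition (D : set X) (f : X -> R) :
  measurable D -> measurable_fun D f ->
  (\int[nu]_(x in D) (f x)%:E =
   \sum_(k : K) \int[nu]_(x in D `&` h @^-1` [set k]) (f x)%:E)%E.
Proof.
move=> mD mf.
have DE : D = \big[setU/set0]_(k <- index_enum K) (D `&` h @^-1` [set k]).
  rewrite -bigcup_seq; apply/seteqP; split=> [x Dx|x [k _ []]//].
  by exists (h x) => //=; rewrite mem_index_enum.
rewrite {1}DE integral_bigsetU_EFin//.
- by move=> k; exact: measurableI.
- exact: index_enum_uniq.
- by move=> k k' _ _ [x [[_ <-] [_ <-]]].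
- by rewrite -DE; exact/measurable_EFinP.
Qed.

Lemma measure_finite_partition (D : set X) : measurable D ->
  (nu D = \sum_(k : K) nu (D `&` h @^-1` [set k]))%E.
Proof.
have nuE (A : set X) : measurable A -> (nu A = \int[nu]_(x in A) 1%:E)%E.
  by move=> mA; rewrite integral_cst// mul1e.
move=> mD; rewrite nuE// integral_finite_partition//.
by apply: eq_bigr => k _; rewrite -nuE//; exact: measurableI.
Qed.

Lemma integral_comp_finite (D : set X) (g : K -> R) : measurable D ->
  (\int[nu]_(x in D) (g (h x))%:E =
   \sum_(k : K) (g k)%:E * nu (D `&` h @^-1` [set k]))%E.
Proof.
move=> mD; rewrite integral_finite_partition//; last first.
  exact: measurable_fun_comp_finite.
apply: eq_bigr => k _; rewrite -integral_cst; last exact: measurableI.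
by apply: eq_integral => x /set_mem[_ /= ->].
Qed.

Lemma integrable_mul_comp_finite (u : X -> R) (g : K -> R) :
  nu.-integrable setT (EFin \o u) ->
  nu.-integrable setT (EFin \o (fun x => u x * g (h x))).
Proof.
move=> iu; have mg := measurable_fun_comp_finite g (D := setT).
suff bg : [bounded g (h x) | x in setT].
  exact: (integrableMl measurableT iu mg bg).
exists (\sum_k `|g k|); split; first exact: num_real.
move=> M /ltW sM x _ /=; apply: le_trans sM.
by rewrite (bigD1 (h x))//= lerDl sumr_ge0.
Qed.

Lemma Rintegral_mul_comp_finite (u : X -> R) (g : K -> R) :
  nu.-integrable setT (EFin \o u) ->
  \int[nu]_x (u x * g (h x)) =
  \sum_(k : K) (\int[nu]_(x in h @^-1` [set k]) u x) * g k.
Proof.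
move=> iu; have iug := integrable_mul_comp_finite g iu.
have /measurable_EFinP mug := measurable_int _ iug.
rewrite /Rintegral integral_finite_partition// -sum_fine; last first.
  move=> k _; rewrite setTI; apply: integrable_fin_num => //.
  exact: integrableS iug.
apply: eq_bigr => k _; rewrite setTI -RintegralZr//; last exact: integrableS iu.
by congr fine; apply: eq_integral => x /set_mem /= ->.
Qed.

Lemma sum_preimage_mul_conj (u v : X -> R) (G : K -> R[i]) :
  nu.-integrable setT (EFin \o u) -> nu.-integrable setT (EFin \o v) ->
  \sum_(k : K) ((\int[nu]_(x in h @^-1` [set k]) u x) +i*
                (\int[nu]_(x in h @^-1` [set k]) v x))%C * (G k)^*%C =
  ((\int[nu]_x (u x * complex.Re (G (h x)) + v x * complex.Im (G (h x)))) +i*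
   (\int[nu]_x (v x * complex.Re (G (h x)) - u x * complex.Im (G (h x)))))%C.
Proof.
move=> iu iv; pose reG k := complex.Re (G k); pose imG k := complex.Im (G k).
have mul_int w g := @integrable_mul_comp_finite w g.
rewrite [LHS]complexE Re_sum Im_sum [RHS]complexE /=.
rewrite (RintegralD measurableT (mul_int u reG iu) (mul_int v imG iv)).
rewrite (RintegralB measurableT (mul_int v reG iv) (mul_int u imG iu)).
rewrite !(Rintegral_mul_comp_finite reG)// !(Rintegral_mul_comp_finite imG)//.
rewrite -big_split -sumrB; congr (_%:C + _ * _%:C)%C; apply: eq_bigr => k _.
  by rewrite /reG /imG; case: (G k) => x y /=; ring.
by rewrite /reG /imG; case: (G k) => x y /=; ring.
Qed.

End FiniteValued.

Lemma Rintegral_comp_finite d (X : measurableType d) (R : realType)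
    (K : finType) (nu : {finite_measure set X -> \bar R}) (h : X -> K)
    (D : set X) (g : K -> R) :
  (forall k, measurable (h @^-1` [set k])) -> measurable D ->
  \int[nu]_(x in D) g (h x) =
  \sum_(k : K) g k * fine (nu (D `&` h @^-1` [set k])).
Proof.
move=> mh mD; have fin_piece k : nu (D `&` h @^-1` [set k]) \is a fin_num.
  by apply: fin_num_measure; exact: measurableI.
rewrite /Rintegral (integral_comp_finite nu mh)// -sum_fine => [|k _].
  by apply: eq_bigr => k _; rewrite fineM// fin_piece.
by rewrite fin_numM// fin_piece.
Qed.

Lemma Rintegral_dist d (X : measurableType d) (R : realType)
    (nu : {finite_measure set X -> \bar R}) (D : set X) (f g : X -> R) (c : R) :
  measurable D ->
  nu.-integrable D (EFin \o f) -> nu.-integrable D (EFin \o g) ->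
  (forall x, `|f x - g x| <= c) ->
  `|\int[nu]_(x in D) f x - \int[nu]_(x in D) g x| <= c * fine (nu D).
Proof.
move=> mD iF iG fg; rewrite -RintegralB//.
have ifg : nu.-integrable D (EFin \o (fun x => f x - g x)).
  by apply: eq_integrable (integrableB mD iF iG) => // x _; rewrite /= EFinB.
apply: (le_trans (le_normr_Rintegral mD ifg)).
rewrite -Rintegral_cst//; apply: le_Rintegral => //.
  exact: eq_integrable (integrable_abse ifg).
exact: finite_measure_integrable_cst.
Qed.

Lemma integrable_sqr_integrable d (X : measurableType d) (R : realType)
    (nu : {finite_measure set X -> \bar R}) (u : X -> R) :
  measurable_fun setT u -> nu.-integrable setT (fun x => (u x ^+ 2)%:E) ->
  nu.-integrable setT (EFin \o u).
Proof.
move=> mfu iu2; have i1 := finite_measure_integrable_cst nu 1 measurableT.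
have := integrableD measurableT i1 iu2.
apply: le_integrable => //; first exact/measurable_EFinP.
move=> x _ /=; rewrite lee_fin [leRHS]ger0_norm; last first.
  by rewrite addr_ge0// sqr_ge0.
by rewrite -real_normK ?num_real//; have := sqr_ge0 (`|u x| - 2^-1); nra.
Qed.

Lemma ae_eq0_pi_system d (X : measurableType d) (R : realType)
    (nu : {measure set X -> \bar R}) (G : set (set X)) (u : X -> R) :
  @measurable _ X = <<s G >> -> setI_closed G -> G setT ->
  nu.-integrable setT (EFin \o u) ->
  (forall A, G A -> \int[nu]_(x in A) (u x)%:E = 0)%E ->
  {ae nu, forall x, u x = 0}.
Proof.
move=> mG GI GT iu u0; have mfu := measurable_int _ iu.
have uA A : measurable A -> (\int[nu]_(x in A) (u x)%:E = 0)%E.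
  rewrite mG; move: A.
  apply: (dynkin_induction
    (P := fun A => \int[nu]_(x in A) (u x)%:E = 0)%E mG GI).
  - exact: u0.
  - exact: u0.
  - move=> S mS uS; have := u0 _ GT; rewrite -(setUv S) integral_setU_EFin//.
    + by rewrite uS add0e.
    + exact: measurableC.
    + by rewrite setUv; exact/measurable_EFinP.
    + by rewrite disj_set2E setICr.
  - move=> F mF tF uF; rewrite integral_bigcup//; first by rewrite eseries0.
    by apply: integrableS iu => //; exact: bigcupT_measurable.
have u_ae := integral_ae_eq measurableT iu (measurable_cst 0%E).
apply: filterS (u_ae _) => [x /(_ I)[]//|A _ mA].
by rewrite uA// integral0.
Qed.

Lemma measure_probability d (X : measurableType d) (R : realType)
    (nu : {measure set X -> \bar R}) : nu setT = 1%E ->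
  exists P : probability X R, nu = P.
Proof.
case: nu => nu' c /= nu1; pose nu : {measure set X -> \bar R} := HB.pack nu' c.
pose P : probability X R :=
  HB.pack nu' c (Measure_isProbability.Build _ _ _ nu nu1).
by exists P; congr Measure.Pack; case: (c).
Qed.

Notation word p n := {ffun 'I_n -> digit p}.

Definition trunc (p n : nat) (x : Zp_dig p) : word p n :=
  [ffun i : 'I_n => x i].

Definition untrunc (p n : nat) (t : word p n) : Zp_dig p :=
  fun i => if insub i is Some j then t j else ord0.

Definition fiber (p n : nat) (t : word p n) : set (Zpadic p) :=
  trunc n @^-1` [set t].

Definition rev_digits (p n : nat) (x : Zp_dig p) : Zp_dig p :=
  fun i => x (n - i.+1)%N.

Definition bump_digit (p n : nat) (i : 'I_n) (t : word p n) : word p n :=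
  [ffun j => if j == i then ordS (t j) else t j].

Section Truncation.
Variable p : nat.
Implicit Types x y : Zp_dig p.

Lemma trunc_eqP n x y :
  trunc n x = trunc n y <-> (forall i, (i < n)%N -> x i = y i).
Proof.
split=> [/ffunP e i lin|e]; first by have := e (Ordinal lin); rewrite !ffunE.
by apply/ffunP => i; rewrite !ffunE e.
Qed.

Lemma trunc_eqS n x y :
  trunc n.+1 x = trunc n.+1 y <-> trunc n x = trunc n y /\ x n = y n.
Proof.
rewrite !trunc_eqP; split=> [e|[e en] i].
  by split=> [i lin|]; apply: e => //; exact: ltnW.
by rewrite ltnS leq_eqVlt => /predU1P[->//|]; exact: e.
Qed.

Lemma trunc_eq_le m n x y : (m <= n)%N -> trunc n x = trunc n y ->
  trunc m x = trunc m y.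
Proof. by move=> mn; rewrite !trunc_eqP => e i im; apply/e/(leq_trans im). Qed.

Lemma trunc_neq_first n x y : trunc n x != trunc n y ->
  exists i, [/\ (i < n)%N, trunc i x = trunc i y & x i != y i].
Proof.
elim: n => [|n ih] xy; first by case/eqP: xy; apply/ffunP => -[].
have [e|/ih[i [/ltnW]]] := eqVneq (trunc n x) (trunc n y); last by exists i.
by exists n; split=> //; apply: contra_neq xy => en; apply/trunc_eqS.
Qed.

Lemma untruncE n (t : word p n) (i : 'I_n) : untrunc t i = t i.
Proof. by rewrite /untrunc insubT //= => lt; congr (t _); apply: val_inj. Qed.

Lemma untruncK n : cancel (@untrunc p n) (@trunc p n).
Proof. by move=> t; apply/ffunP => i; rewrite ffunE untruncE. Qed.

Lemma cylinderE n x : cylinder n x = fiber (trunc n x).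
Proof. by apply/seteqP; split=> y /trunc_eqP. Qed.

Lemma bump_digit_inj n (i : 'I_n) : injective (@bump_digit p n i).
Proof.
move=> t s /ffunP e; apply/ffunP => j; have := e j; rewrite !ffunE.
by case: ifP => // _; exact: ordS_inj.
Qed.

Lemma untrunc_bump n (i : 'I_n) (t : word p n) j :
  untrunc (bump_digit i t) j =
  if j == i then ordS (untrunc t j) else untrunc t j.
Proof.
rewrite /untrunc; case: insubP => [k _ <-|]; first by rewrite ffunE.
by case: eqP => // ->; rewrite ltn_ord.
Qed.

End Truncation.

Section Digits.
Variable p : nat.
Hypothesis p_gt0 : (0 < p)%N.
Implicit Types x y z : Zp_dig p.

Lemma digit_lt (d : digit p) : (d < p)%N.
Proof. by apply: leq_trans (ltn_ord d) _; rewrite prednK. Qed.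

Lemma ordS_int (d : digit p) :
  exists e : int, (ordS d)%:Z = d%:Z + 1 + p%:Z * e.
Proof.
exists (- (d.+1 %/ p)%N%:Z) => /=.
have -> : (d.+1 %% p.-1.+1 = d.+1 %% p)%N by congr (_ %% _)%N; rewrite prednK.
by have := divn_eq d.+1 p; lia.
Qed.

Lemma zvalS n x : zval n.+1 x = (zval n x + x n * p ^ n)%N.
Proof. by rewrite /zval big_ord_recr. Qed.

Lemma zval_lt n x : (zval n x < p ^ n)%N.
Proof.
elim: n => [|n ih]; first by rewrite /zval big_ord0.
rewrite zvalS expnS; apply: (@leq_trans ((x n).+1 * p ^ n)).
  by rewrite mulSn ltn_add2r.
by rewrite leq_mul2r digit_lt orbT.
Qed.

Lemma zval_trunc n x y : trunc n x = trunc n y -> zval n x = zval n y.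
Proof. by move=> /trunc_eqP e; apply: eq_bigr => i _; rewrite e. Qed.

Lemma zval_untrunc n x : zval n (untrunc (trunc n x)) = zval n x.
Proof. by apply: zval_trunc; rewrite untruncK. Qed.

Lemma zval_split m n x : (m <= n)%N ->
  exists w, zval n x = (zval m x + w * p ^ m)%N.
Proof.
move=> /subnKC <-; elim: (n - m)%N => [|k [w ih]].
  by exists 0%N; rewrite addn0 mul0n addn0.
exists (w + x (m + k) * p ^ k)%N.
by rewrite addnS zvalS ih expnD mulnDl -addnA mulnAC mulnA.
Qed.

Lemma zval_mod m n x : (m <= n)%N -> (zval n x %% p ^ m)%N = zval m x.
Proof.
by move=> /(zval_split x)[w ->]; rewrite addnC modnMDl modn_small ?zval_lt.
Qed.

Lemma zval_div n x : (zval n.+1 x %/ p ^ n)%N = x n.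
Proof.
by rewrite zvalS addnC divnMDl ?expn_gt0 ?p_gt0// divn_small ?zval_lt ?addn0.
Qed.

Lemma zval_inj n x y : zval n x = zval n y -> trunc n x = trunc n y.
Proof.
move=> e; apply/trunc_eqP => i lin; apply: val_inj => /=.
by rewrite -(zval_div i x) -(zval_div i y) -!(zval_mod _ lin) e.
Qed.

Lemma zval_sub i n x y : (i < n)%N -> trunc i x = trunc i y ->
  exists e : int, (zval n x)%:Z - (zval n y)%:Z =
    (p ^ i)%:Z * ((x i)%:Z - (y i)%:Z + p%:Z * e).
Proof.
move=> lin /zval_trunc xy; have [w ->] := zval_split x lin.
have [v ->] := zval_split y lin; exists (w%:Z - v%:Z).
by rewrite !zvalS xy expnS !(PoszD, PoszM); ring.
Qed.

Lemma zval_coherent (a : nat -> nat) : (forall n, a n < p ^ n)%N ->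
    (forall n, a n.+1 %% p ^ n = a n)%N ->
  forall n, zval n (fun i => inord (a i.+1 %/ p ^ i)%N : digit p) = a n.
Proof.
move=> alt amod; elim=> [|n ih].
  by rewrite /zval big_ord0; have := alt 0%N; rewrite expn0; case: (a 0%N).
rewrite zvalS ih inordK; last first.
  by rewrite prednK// ltn_divLR ?expn_gt0 ?p_gt0// -expnS.
by rewrite -{1}(amod n) addnC -divn_eq.
Qed.

Lemma zval_add n x y : zval n (zp_add x y) = ((zval n x + zval n y) %% p ^ n)%N.
Proof.
apply: (zval_coherent (a := fun n => (zval n x + zval n y) %% p ^ n)%N) => k.
  by rewrite ltn_mod expn_gt0 p_gt0.
by rewrite modn_dvdm ?dvdn_exp2l// -modnDm !zval_mod.
Qed.

Lemma zp_sub_exists x z : exists y, forall n,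
  zval n y = ((zval n z + (p ^ n - zval n x)) %% p ^ n)%N.
Proof.
pose a n := ((zval n z + (p ^ n - zval n x)) %% p ^ n)%N.
exists (fun i => inord (a i.+1 %/ p ^ i)%N); apply: zval_coherent => n.
  by rewrite ltn_mod expn_gt0 p_gt0.
rewrite /a modn_dvdm ?dvdn_exp2l//; apply/eqP; rewrite -(eqn_modDr (zval n x)).
rewrite -[in X in _ == X]addnA subnK; last exact/ltnW/zval_lt.
rewrite -[in X in X == _](zval_mod x (leqnSn n)) modnDmr -addnA.
rewrite subnK; last exact/ltnW/zval_lt.
by rewrite expnS -modnDmr modnMl addn0 modnDr zval_mod// modn_small// zval_lt.
Qed.

Lemma zp_add_cylinder n x : zp_add x @` cylinder n (fun=> ord0) = cylinder n x.
Proof.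
have z0 : zval n (fun=> ord0 : digit p) = 0%N by rewrite /zval big1.
have xn k : (zval k x <= p ^ k)%N by exact/ltnW/zval_lt.
rewrite !cylinderE; apply/seteqP; split=> [_ [y y0 <-]|z zx].
  rewrite /fiber /=; apply: zval_inj; rewrite zval_add (zval_trunc y0) z0.
  by rewrite addn0 modn_small ?zval_lt.
have [y yE] := zp_sub_exists x z; exists y.
  rewrite /fiber /=; apply: zval_inj.
  by rewrite yE (zval_trunc zx) subnKC ?modnn.
apply/funext => k; suff /zval_inj/trunc_eqS[] :
  zval k.+1 (zp_add x y) = zval k.+1 z by [].
by rewrite zval_add yE modnDmr addnC -addnA subnK// modnDr modn_small ?zval_lt.
Qed.

Lemma zval_rev (F : numFieldType) n x :
  (zval n (rev_digits n x))%:R / p%:R ^+ n =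
  \sum_(i < n) (x i)%:R / p%:R ^+ i.+1 :> F.
Proof.
rewrite /zval (reindex_inj rev_ord_inj) natr_sum mulr_suml.
apply: eq_bigr => i _.
rewrite /rev_digits /= subnSK// subKn; last exact: ltnW.
have -> : p%:R ^+ n = p%:R ^+ (n - i.+1) * p%:R ^+ i.+1 :> F.
  by rewrite -exprD subnK.
rewrite natrM natrX [X in X / _]mulrC -mulf_div mulfV ?mul1r//.
by rewrite expf_neq0// pnatr_eq0 -lt0n.
Qed.

End Digits.

Section Topology.
Variable p : nat.

Lemma zp_open_trunc n (A : set (word p n)) : zp_open (trunc n @^-1` A).
Proof. by move=> x Ax; exists n; rewrite cylinderE /fiber => y /= ->. Qed.

Lemma measurable_zp_open (A : set (Zpadic p)) : zp_open A -> measurable A.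
Proof. exact: sub_sigma_algebra. Qed.

Lemma measurable_fiber n (t : word p n) : measurable (fiber t).
Proof. by apply: measurable_zp_open; exact: (@zp_open_trunc n [set t]). Qed.

Definition fibers : set (set (Zpadic p)) :=
  [set A | A = set0 \/ exists n (t : word p n), A = fiber t].

Lemma fibers_setI : setI_closed fibers.
Proof.
move=> A B [->|[n [t ->]]]; first by rewrite set0I; left.
move=> [->|[m [s ->]]]; first by rewrite setI0; left.
wlog nm : n t m s / (n <= m)%N => [h|].
  by have [|/ltnW] := leqP n m; [|rewrite setIC]; exact: h.
have ts x : fiber s x -> trunc n x = trunc n (untrunc s).
  by move=> xs; apply: trunc_eq_le nm _; rewrite untruncK.
have [e|ne] := eqVneq (trunc n (untrunc s)) t.
  by right; exists m, s; apply/setIidPr => x /ts xs; rewrite /fiber/= xs.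
left; apply/seteqP; split=> // x [xt /ts xs].
by case/eqP: ne; rewrite -xs.
Qed.

Lemma fibers_setT : fibers setT.
Proof.
right; exists 0%N, [ffun=> ord0]; apply/seteqP; split=> // x _.
by apply/ffunP => -[].
Qed.

Lemma measurable_fibersE : @measurable _ (Zpadic p) = <<s fibers >>.
Proof.
apply/seteqP; split; last first.
  apply: smallest_sub; first exact: sigma_algebra_measurable.
  by move=> _ [->//|[n [t ->]]]; exact: measurable_fiber.
apply: smallest_sub; first exact: smallest_sigma_algebra.
move=> A oA.
pose inner n := [set t : word p n | fiber t `<=` A].
have -> : A = \bigcup_n \bigcup_(t in inner n) fiber t.
  apply/seteqP; split=> [x Ax|x [n _ [t tA]]]; last exact: tA.
  have [n] := oA _ Ax; rewrite cylinderE => nA.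
  by exists n => //; exists (trunc n x).
apply: (@bigcupT_measurable _ (g_sigma_algebraType fibers)) => n.
apply: fin_bigcup_measurable => [|t _]; first exact: finite_finset.
by apply: sub_sigma_algebra; right; exists n, t.
Qed.

(* [Zp_dig p] carries no topology of its own; compactness is borrowed from this
   convertible product of finite discrete spaces. *)
Local Notation product_space :=
  (prod_topology (fun _ : nat => discrete_topology (digit p))).

Let nbhs_cylinder n (x : product_space) : nbhs x (cylinder n x).
Proof.
have nbhs_filter_x : Filter (nbhs x) := @nbhs_filter product_space x.
elim: n => [|n ih]; first exact: filterS filterT.
have xn := @proj_continuous nat (fun=> discrete_topology (digit p)) n x _
  (discrete_set1 _).
apply: filterS (filterI ih xn) => y [yx yn] i.
by rewrite ltnS leq_eqVlt => /predU1P[->//|/yx].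
Qed.

Let product_space_compact : compact [set: product_space].
Proof.
have compactT : compact [set: discrete_topology (digit p)].
  by apply: finite_compact; exact: (@finite_finset (digit p)).
have := @tychonoff nat (fun=> discrete_topology (digit p)) _ (fun=> compactT).
by congr compact; apply/seteqP.
Qed.

Variable R : realType.
Implicit Types f : Zpadic p -> R.

Lemma zp_continuous_trunc n (g : word p n -> R) :
  zp_continuous (fun x => g (trunc n x)).
Proof. by move=> U _; exact: (@zp_open_trunc n (g @^-1` U)). Qed.

Lemma zp_continuous_measurable f : zp_continuous f -> measurable_fun setT f.
Proof.
move=> cf; apply: (measurability _ (RGenOpens.measurableE R)).
move=> _ [_ [a [b ->]] <-]; rewrite setTI.
by apply: measurable_zp_open; apply: cf; exact: interval_open.
Qed.

Lemma zp_uniform_continuity f : zp_continuous f -> forall e : R, 0 < e ->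
  exists N, forall x y, trunc N x = trunc N y -> `|f x - f y| < e.
Proof.
move=> cf e e0; have e2 : 0 < e / 2 by rewrite divr_gt0.
have := (compact_near_coveringP _).1 product_space_compact nat \oo
  (fun N x => forall y, trunc N x = trunc N y -> `|f x - f y| < e).
case=> [x _|N _ /(_ N (leqnn N)) fN]; last first.
  by exists N => x y; exact: fN.
have [n xn] := cf _ (ball_open (f x) (e / 2)) x (ballxx (f x) e2).
exists (cylinder n x, [set N | (n <= N)%N]).
  by split; [exact: nbhs_cylinder|exact: nbhs_infty_ge].
move=> [z N] [/= zx nN] y zy.
have yx : cylinder n x y.
  move=> i lin; rewrite -zx//; have /trunc_eqP -> // := zy.
  exact: leq_trans nN.
rewrite [e]splitr; exact: ball_triangle (ball_sym (xn z zx)) (xn y yx).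
Qed.

Lemma zp_continuous_bounded f :
  zp_continuous f -> exists M, forall x, `|f x| <= M.
Proof.
move=> cf; have [N fN] := zp_uniform_continuity cf ltr01.
exists (1 + \sum_(t : word p N) `|f (untrunc t)|) => x.
rewrite -[f x](subrK (f (untrunc (trunc N x)))).
apply: (le_trans (ler_normD _ _)); apply: lerD.
  by apply/ltW/fN; rewrite untruncK.
by rewrite (bigD1 (trunc N x))//= lerDl sumr_ge0.
Qed.

Lemma zp_continuous_integrable (P : probability (Zpadic p) R)
    (D : set (Zpadic p)) f :
  measurable D -> zp_continuous f -> P.-integrable D (EFin \o f).
Proof.
move=> mD cf; apply: measurable_bounded_integrable => //.
- by rewrite (le_lt_trans (probability_le1 P mD)) ?ltry.
- by apply: measurable_funTS; exact: zp_continuous_measurable.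
have [M fM] := zp_continuous_bounded cf.
exists M; split=> [|y My x _ /=]; first exact: num_real.
exact: le_trans (fM x) (ltW My).
Qed.

Lemma ae_eq0_fiber (nu : {measure set (Zpadic p) -> \bar R}) f :
  nu.-integrable setT (EFin \o f) ->
  (forall n (t : word p n), \int[nu]_(x in fiber t) f x = 0) ->
  {ae nu, forall x, f x = 0}.
Proof.
move=> intf f0; apply: (ae_eq0_pi_system measurable_fibersE) => //.
- exact: fibers_setI.
- exact: fibers_setT.
move=> _ [->|[n [t ->]]]; first by rewrite integral_set0.
have int_t : nu.-integrable (fiber t) (EFin \o f).
  by apply: integrableS intf => //; exact: measurable_fiber.
rewrite -(fineK (integrable_fin_num (measurable_fiber t) int_t)).
by congr EFin; exact: f0.
Qed.

End Topology.

Section Averages.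
Variables (R : realType) (p : nat) (m mu : probability (Zpadic p) R).
Variable A : nat -> set (Zpadic p).
Hypothesis measurable_A : forall n, measurable (A n).
Hypothesis A_gt0 : forall n, (0 < m (A n))%E.
Hypothesis A_fiber : forall n (t : word p n),
  (m (A n `&` fiber t) = m (A n) * mu (fiber t))%E.

Let fine_A_gt0 n : 0 < fine (m (A n)).
Proof. by rewrite fine_gt0// A_gt0 ltey_eq fin_num_measure. Qed.

Lemma Rintegral_trunc_average n (g : word p n -> R) :
  \int[m]_(x in A n) g (trunc n x) = fine (m (A n)) * \int[mu]_x g (trunc n x).
Proof.
have m_fiber := @measurable_fiber p n.
rewrite !(Rintegral_comp_finite _ _ m_fiber)// mulr_sumr.
apply: eq_bigr => t _; rewrite setTI /= A_fiber fineM ?fin_num_measure//.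
by rewrite mulrCA.
Qed.

Lemma average_dist_le n (f : Zpadic p -> R) (e : R) : zp_continuous f ->
  (forall x y, trunc n x = trunc n y -> `|f x - f y| <= e) ->
  `|(\int[m]_(x in A n) f x) / fine (m (A n)) - \int[mu]_x f x| <= e + e.
Proof.
move=> cf fe; set a := fine _; have a0 : 0 < a := fine_A_gt0 n.
pose fn (x : Zpadic p) := f (untrunc (trunc n x)).
have cfn : zp_continuous fn.
  exact: (@zp_continuous_trunc p R n (fun t => f (untrunc t))).
have fnE : \int[m]_(x in A n) fn x = a * \int[mu]_x fn x.
  exact: (Rintegral_trunc_average (fun t => f (untrunc t))).
have ffn x : `|f x - fn x| <= e by apply: fe; rewrite untruncK.
have dist_le (P : probability (Zpadic p) R) D : measurable D ->
    `|\int[P]_(x in D) f x - \int[P]_(x in D) fn x| <= e * fine (P D).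
  by move=> mD; apply: Rintegral_dist => //; exact: zp_continuous_integrable.
have := dist_le mu setT measurableT.
rewrite probability_setT mulr1 distrC => mu_le.
have := dist_le m (A n) (measurable_A n); rewrite fnE => m_le.
rewrite -(subrKA (\int[mu]_x fn x)); apply: (le_trans (ler_normD _ _)).
apply: lerD => //; rewrite -(ler_pM2r a0) -[X in _ * X](gtr0_norm a0).
by rewrite -normrM mulrBl divfK ?gt_eqF// [X in _ - X]mulrC.
Qed.

Lemma cvg_average (f : Zpadic p -> R) : zp_continuous f ->
  (\int[m]_(x in A n) f x) / fine (m (A n)) @[n --> \oo] --> \int[mu]_x f x.
Proof.
move=> cf; apply/cvgrPdist_le => e e0; have e2 : 0 < e / 2 by rewrite divr_gt0.
have [N fN] := zp_uniform_continuity cf e2.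
near=> n; rewrite distrC [e]splitr; apply: average_dist_le => // x y xy.
by apply/ltW/fN; apply: trunc_eq_le xy; near: n; exact: nbhs_infty_ge.
Unshelve. all: by end_near.
Qed.

End Averages.

Section Fill.
Variables (p : nat) (J : set nat) (phi : forall j : nat, word p j -> digit p).
Implicit Types x y s : Zp_dig p.

Fixpoint fill_upto n x : Zp_dig p :=
  if n is k.+1 then
    let y := fill_upto k x in
    fun i => if `[< J k >] && (i == k) then phi (trunc k y) else y i
  else x.

Definition fill (x : Zpadic p) : Zpadic p := fun i => fill_upto i.+1 x i.

Lemma fill_upto_ge n x i : (n <= i)%N -> fill_upto n x i = x i.
Proof.
elim: n => [//|n ih] ni /=; rewrite gtn_eqF// andbF ih//; exact: ltnW.
Qed.

Lemma fill_upto_lt n x i : (i < n)%N -> fill_upto n x i = fill x i.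
Proof.
elim: n => [//|n ih]; rewrite ltnS leq_eqVlt => /predU1P[->//|lin] /=.
by rewrite ltn_eqF// andbF ih.
Qed.

Lemma fill_J j x : J j -> fill x j = phi (trunc j (fill x)).
Proof.
move=> Jj; rewrite {1}/fill /= eqxx asboolT//=; congr (phi _).
by apply/trunc_eqP => i; exact: fill_upto_lt.
Qed.

Lemma fill_notJ i x : ~ J i -> fill x i = x i.
Proof. by move=> Ji; rewrite /fill /= asboolF//= fill_upto_ge. Qed.

Lemma fill_trunc n x y : trunc n x = trunc n y ->
  trunc n (fill x) = trunc n (fill y).
Proof.
elim: n => [|n ih]; first by move=> _; apply/ffunP => -[].
move=> /trunc_eqS[/ih xy xyn]; apply/trunc_eqS; split=> //.
have [Jn|Jn] := pselect (J n); first by rewrite !fill_J// xy.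
by rewrite !fill_notJ.
Qed.

Lemma measurable_fill : measurable_fun setT fill.
Proof.
apply: (@measurability _ _ (Zpadic p) (Zpadic p) _ _ (@zp_open p)) => //.
move=> _ [U oU <-]; rewrite setTI; apply: measurable_zp_open => x Ux.
have [n] := oU _ Ux; rewrite cylinderE => nU; exists n.
by rewrite cylinderE => y yx; apply: nU; exact: fill_trunc.
Qed.

HB.instance Definition _ := isMeasurableFun.Build _ _ _ _ fill measurable_fill.

Hypothesis p_gt0 : (0 < p)%N.

Lemma OmegaE n : Omega J phi n =
  [set x | forall j, J j -> (j < n)%N -> x j = phi (trunc j x)].
Proof.
apply/seteqP; split=> [x [c [t [tJ ->]]] /(zval_inj p_gt0) xt|x xJ].
  move=> j Jj jn; have /trunc_eqP -> // := xt.
  by rewrite tJ//; congr (phi _); exact/esym/(trunc_eq_le (ltnW jn) xt).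
by exists (zval n x) => //; exists x; split.
Qed.

Lemma Omega_trunc n x y : trunc n x = trunc n y ->
  Omega J phi n x -> Omega J phi n y.
Proof.
move=> xy; rewrite OmegaE//= => xJ j Jj jn.
by move/trunc_eqP : (xy) => <-//; rewrite xJ// (trunc_eq_le (ltnW jn) xy).
Qed.

Lemma Omega_untrunc n x :
  Omega J phi n (untrunc (trunc n x)) <-> Omega J phi n x.
Proof. by split; apply: Omega_trunc; rewrite untruncK. Qed.

Lemma Omega_le m n : (m <= n)%N -> Omega J phi n `<=` Omega J phi m.
Proof.
move=> mn x; rewrite !OmegaE// => xJ j Jj jm.
by apply: xJ => //; exact: leq_trans mn.
Qed.

Lemma measurable_Omega n : measurable (Omega J phi n).
Proof.
apply: measurable_zp_open => x Ox; exists n => y.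
by rewrite cylinderE => yx; exact: Omega_trunc Ox.
Qed.

Lemma Omega_fill n x : Omega J phi n (fill x).
Proof. by rewrite OmegaE => j Jj _; exact: fill_J. Qed.

Lemma trunc_fill_eqP n x s : Omega J phi n s ->
  trunc n (fill x) = trunc n s <-> (forall i, (i < n)%N -> ~ J i -> x i = s i).
Proof.
rewrite OmegaE => sJ; split=> [/trunc_eqP e i lin Ji|xs].
  by rewrite -fill_notJ// e.
apply/trunc_eqP => i; elim/ltn_ind: i => i ih lin.
have [Ji|Ji] := pselect (J i); last by rewrite fill_notJ// xs.
rewrite fill_J// sJ//; congr (phi _); apply/trunc_eqP => k ki.
by apply: ih => //; exact: ltn_trans lin.
Qed.

Lemma Omega_agree i n x y : (i < n)%N -> Omega J phi n x -> Omega J phi n y ->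
  trunc i x = trunc i y -> J i -> x i = y i.
Proof. by rewrite OmegaE => lin xJ yJ xy Ji; rewrite xJ// yJ// xy. Qed.

Definition num_forced n := (\sum_(i < n) `[< J i >])%N.

Lemma num_forcedS n : num_forced n.+1 = (num_forced n + `[< J n >])%N.
Proof. by rewrite /num_forced big_ord_recr. Qed.

Lemma num_forced_le : {homo num_forced : k n / (k <= n)%N}.
Proof.
apply: homo_leq => [//|k n l|n]; first exact: leq_trans.
by rewrite num_forcedS leq_addr.
Qed.

Lemma num_forced_unbounded :
  infinite_set J -> forall k, exists n, (k <= num_forced n)%N.
Proof.
move=> Jinf; elim=> [|k [n kn]]; first by exists 0%N.
have [j nj Jj] : exists2 j, (n <= j)%N & J j.
  apply: contrapT => h; apply: Jinf; apply: (@sub_finite_set _ _ `I_n) => //.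
  by move=> j Jj /=; rewrite ltnNge; apply/negP => nj; apply: h; exists j.
exists j.+1; rewrite num_forcedS asboolT// addn1 ltnS.
by rewrite (leq_trans kn)// num_forced_le.
Qed.

Lemma card_fill_fiber n (t : word p n) : Omega J phi n (untrunc t) ->
  #|[pred s : word p n | trunc n (fill (untrunc s)) == t]| =
  (p ^ num_forced n)%N.
Proof.
move=> tO; pose choices (i : 'I_n) : pred (digit p) :=
  fun d => `[< J i >] || (d == t i).
transitivity #|family choices|.
  apply: eq_card => s; rewrite [LHS]inE -{1}(untruncK t).
  apply/eqP/familyP => [/trunc_fill_eqP st i|st].
    rewrite /choices unfold_in; case: asboolP => //= Ji.
    by rewrite -(untruncE t) -(untruncE s) st.
  apply/trunc_fill_eqP => // i lin Ji; have := st (Ordinal lin).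
  rewrite /choices unfold_in asboolF//= => /eqP.
  by rewrite -(untruncE t) -(untruncE s).
rewrite card_family foldrE big_map big_enum/= expn_sum; apply: eq_bigr => i _.
case: asboolP => Ji.
  rewrite expn1 -[RHS](prednK p_gt0) -[RHS]card_ord; apply: eq_card => d.
  by rewrite /choices unfold_in asboolT.
rewrite expn0 -(card1 (t i)); apply: eq_card => d.
by rewrite /choices !inE unfold_in asboolF.
Qed.

End Fill.

Section Haar.
Variables (R : realType) (p : nat) (m : probability (Zpadic p) R).
Hypothesis p_gt0 : (0 < p)%N.
Hypothesis m_translation : forall (a : Zpadic p) (A : set (Zpadic p)),
  measurable A -> m (zp_add a @` A) = m A.

Let pR_neq0 : p%:R != 0 :> R.
Proof. by rewrite pnatr_eq0 -lt0n. Qed.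

Lemma haar_fiber n (t : word p n) : m (fiber t) = (p%:R ^- n)%:E.
Proof.
pose c := m (cylinder n (fun=> ord0)).
have m_fiber (s : word p n) : m (fiber s) = c.
  rewrite -(untruncK s) -cylinderE -zp_add_cylinder// m_translation//.
  by rewrite cylinderE; exact: measurable_fiber.
have /fineK cE : c \is a fin_num.
  by rewrite -(m_fiber t); exact: fin_num_measure (measurable_fiber t).
have : (\sum_(s : word p n) m (fiber s) = 1)%E.
  rewrite -(probability_setT m) (measure_finite_partition m (h := trunc n))//.
    by apply: eq_bigr => s _; rewrite setTI.
  exact: measurable_fiber.
under eq_bigr do rewrite m_fiber -cE; rewrite m_fiber -cE sumEFin => -[].
rewrite sumr_const card_ffun !card_ord prednK// -(mulr_natl (fine c)).
rewrite natrX => e; congr EFin; apply: (mulfI (expf_neq0 n pR_neq0)).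
by rewrite e mulfV ?expf_neq0.
Qed.

Lemma integral_haar_trunc n (g : word p n -> R) :
  (\int[m]_x (g (trunc n x))%:E = (p%:R ^- n * \sum_t g t)%:E)%E.
Proof.
rewrite (integral_comp_finite m (h := trunc n))//; last exact: measurable_fiber.
rewrite mulr_sumr -sumEFin.
by apply: eq_bigr => t _; rewrite setTI /= -/(fiber t) haar_fiber -EFinM mulrC.
Qed.

Variables (J : set nat) (phi : forall j : nat, word p j -> digit p).

Local Notation mu := (distribution m (fill J phi)).

Lemma fill_law_eq0 (A : set (Zpadic p)) :
  (forall x, ~ A (fill J phi x)) -> mu A = 0%E.
Proof.
move=> fillA; rewrite /distribution /pushforward (_ : _ @^-1` _ = set0).
  exact: measure0.
by apply/seteqP; split=> // x /fillA.
Qed.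

Lemma integral_fill_trunc n (g : word p n -> R) :
  (\int[mu]_x (g (trunc n x))%:E =
   (p%:R ^- n * \sum_(t : word p n) g (trunc n (fill J phi (untrunc t))))%:E)%E.
Proof.
have trunc_fill (x : Zp_dig p) :
    trunc n (fill J phi (untrunc (trunc n x))) = trunc n (fill J phi x).
  by apply: fill_trunc; rewrite untruncK.
have gC := @zp_continuous_trunc p R n.
rewrite integral_distribution.
- rewrite -integral_haar_trunc; apply: eq_integral => x _ /=.
  by rewrite trunc_fill.
- by apply/measurable_EFinP; exact: (zp_continuous_measurable (gC g)).
- apply: eq_integrable (zp_continuous_integrable m measurableT
    (gC (fun t => g (trunc n (fill J phi (untrunc t)))))) => // x _.
  by rewrite /= trunc_fill.
Qed.

Lemma fill_law_fiber n (t : word p n) :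
  mu (fiber t) =
  (if `[< Omega J phi n (untrunc t) >] then p%:R ^+ num_forced J n / p%:R ^+ n
   else 0)%:E.
Proof.
case: asboolP => tO; last first.
  apply: fill_law_eq0 => x xt; apply: tO; rewrite -xt.
  exact/(Omega_untrunc _ _ p_gt0)/Omega_fill.
rewrite -(setIT (fiber t)) -integral_indic//; last exact: measurable_fiber.
transitivity (\int[mu]_x ((trunc n x == t)%:R : R)%:E)%E.
  apply: eq_integral => x _; rewrite indicE; congr ((nat_of_bool _)%:R%:E).
  by apply/idP/eqP; rewrite inE.
rewrite (integral_fill_trunc (fun s => (s == t)%:R)) -natr_sum mulrC.
rewrite -[p%:R ^+ num_forced J n]natrX -(card_fill_fiber p_gt0 tO).
rewrite -sum1_card [in RHS]big_mkcond.
by congr ((_%:R / _)%:E); apply: eq_bigr => s _; rewrite inE; case: eqP.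
Qed.

Lemma haar_Omega_fiber n (t : word p n) :
  (m (Omega J phi n `&` fiber t) =
   (p%:R ^- num_forced J n)%:E * mu (fiber t))%E.
Proof.
rewrite fill_law_fiber; case: asboolP => tO.
  rewrite -EFinM mulrA mulVf ?expf_neq0// mul1r -(haar_fiber t); congr (m _).
  by apply/setIidPr => x xt; apply/(Omega_untrunc _ _ p_gt0); rewrite xt.
rewrite mule0 (_ : _ `&` _ = set0) ?measure0//.
apply/seteqP; split=> // x [xO xt].
by apply: tO; rewrite -xt; apply/(Omega_untrunc _ _ p_gt0).
Qed.

Lemma haar_Omega n : m (Omega J phi n) = (p%:R ^- num_forced J n)%:E.
Proof.
have m_fiber := @measurable_fiber p n.
rewrite (measure_finite_partition m m_fiber); last exact: measurable_Omega.
rewrite (eq_bigr _ (fun t _ => haar_Omega_fiber t)) -ge0_sume_distrr//.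
rewrite -[RHS]mule1 -(probability_setT mu).
rewrite (measure_finite_partition mu m_fiber)//.
by congr (_ * _)%E; apply: eq_bigr => t _; rewrite setTI.
Qed.

Lemma fill_law_weak_limit (f : Zpadic p -> R) : zp_continuous f ->
  (\int[m]_(x in Omega J phi n) f x) / fine (m (Omega J phi n)) @[n --> \oo]
    --> \int[mu]_x f x.
Proof.
apply: cvg_average => [n|n|n t]; first exact: measurable_Omega.
  by rewrite haar_Omega lte_fin invr_gt0 exprn_gt0// ltr0n.
by rewrite haar_Omega_fiber haar_Omega.
Qed.

Lemma fill_law_singular : (1 < p)%N -> infinite_set J ->
  exists A : set (Zpadic p), measurable A /\ m A = 0%E /\ mu (~` A) = 0%E.
Proof.
move=> p_gt1 Jinf; exists (\bigcap_n Omega J phi n).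
have mA : measurable (\bigcap_n Omega J phi n).
  by apply: bigcapT_measurable => n; exact: measurable_Omega.
split=> //; split; last first.
  by apply: fill_law_eq0 => x; apply => n _; exact: Omega_fill.
apply/eqP; rewrite eq_le measure_ge0 andbT; apply/lee_addgt0Pr => e e0.
have invp_lt1 : `|p%:R^-1 : R| < 1.
  by rewrite ger0_norm ?invr_ge0 ?ler0n// invf_lt1 ?ltr0n// ltr1n.
have [k _ /(_ k (leqnn k)) ke] := cvgr_lt 0 (cvg_expr invp_lt1) _ e0.
have [n kn] := num_forced_unbounded Jinf k.
rewrite add0e; apply: (@le_trans _ _ (m (Omega J phi n))).
  rewrite le_measure ?inE//; first exact: measurable_Omega.
  exact: bigcap_inf.
rewrite haar_Omega lee_fin -exprVn; apply: le_trans (ltW ke).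
by rewrite ler_wiXn2l ?invr_ge0 ?ler0n// invf_le1 ?ltr0n// ler1n.
Qed.

End Haar.

Section CharacterSums.
Variables (R : realType) (p : nat).
Hypothesis p_gt0 : (0 < p)%N.

Lemma sum_echar_bump (T : finType) (F : T -> Zp_dig p) (tau : T -> T)
    (y z : Zp_dig p) (i j n : nat) :
  n = (i + j).+1 -> injective tau ->
  (forall t, trunc i (F (tau t)) = trunc i (F t)) ->
  (forall t, F (tau t) i = ordS (F t i)) ->
  trunc j y = trunc j z -> y j != z j ->
  \sum_t echar R (p ^ n)
    (((zval n y)%:Z - (zval n z)%:Z) * (zval n (F t))%:Z) = 0.
Proof.
move=> nE tauI tau_lt tau_i yz yzj.
have iln : (i < n)%N by rewrite nE ltnS leq_addr.
have jln : (j < n)%N by rewrite nE ltnS leq_addl.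
have [a ->] := zval_sub jln yz; set d := (y j)%:Z - (z j)%:Z.
apply: (@sum_echar_shift _ _ _ tau ((p ^ (i + j))%:Z * d)) => // [|t|].
- by rewrite expn_gt0 p_gt0.
- have [b bE] := zval_sub iln (tau_lt t); have [e eE] := ordS_int p_gt0 (F t i).
  apply/eqP; rewrite eqz_mod_dvd.
  apply/dvdzP; exists (d * (e + b) + a * (1 + p%:Z * (e + b))).
  rewrite tau_i eE in bE.
  rewrite -(subrK (zval n (F t))%:Z (zval n (F (tau t)))%:Z) bE.
  by rewrite nE expnS expnD !PoszM; ring.
rewrite nE expnSr PoszM dvdz_mul2l; last first.
  by rewrite eqz_nat -lt0n expn_gt0 p_gt0.
have d0 : d != 0 by rewrite subr_eq0 eqz_nat.
apply/negP => /dvdn_leq; rewrite absz_gt0 d0 => /(_ isT).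
by have := digit_lt p_gt0 (y j); have := digit_lt p_gt0 (z j); rewrite /d; lia.
Qed.

End CharacterSums.

Lemma rat_pfactor_reduced (p a n : nat) : prime p ->
  let q : rat := a%:R / p%:R ^+ n in
  exists2 k, (k <= n)%N &
    denq q = (p ^ k)%:Z /\ a%:Z = numq q * (p ^ (n - k))%:Z.
Proof.
move=> p_prime q; have p_gt0 := prime_gt0 p_prime.
have qE : numq q * (p ^ n)%:Z = a%:Z * denq q.
  apply: (@intr_inj rat); rewrite !intrM numqE -!pmulrn natrX /q.
  by rewrite mulrAC divfK// expf_neq0// pnatr_eq0 -lt0n.
have [k kn dk] : exists2 k, (k <= n)%N & `|denq q|%N = (p ^ k)%N.
  apply/dvdn_pfactor => //; rewrite -(@Gauss_dvdr _ `|numq q|).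
    by apply/dvdnP; exists a; rewrite -[a]absz_nat -abszM -qE abszM.
  by rewrite coprime_sym coprime_num_den.
have denqE : denq q = (p ^ k)%:Z by rewrite -dk gez0_abs// denq_ge0.
exists k; rewrite // denqE; split=> //.
have pk0 : (p ^ k)%:Z != 0 by rewrite eqz_nat -lt0n expn_gt0 p_gt0.
apply: (mulIf pk0).
by rewrite -[RHS]mulrA -[in RHS]PoszM -expnD subnK// qE denqE.
Qed.

Lemma expi2pi_phase (R : realType) (p a n : nat) (x : Zp_dig p) : prime p ->
  expi2pi (phase R (a%:R / p%:R ^+ n) x) =
  echar R (p ^ n) (a%:Z * (zval n x)%:Z).
Proof.
move=> p_prime; have p_gt0 := prime_gt0 p_prime.
have pX_gt0 i : (0 < p ^ i)%N by rewrite expn_gt0 p_gt0.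
have [k kn [denqE aE]] := rat_pfactor_reduced a n p_prime.
rewrite /phase denqE absz_nat pfactorK// -pmulrn -/(echar R (p ^ k) _).
have pnE : (p ^ n = p ^ k * p ^ (n - k))%N by rewrite -expnD subnKC.
rewrite echar_mod// aE pnE mulrAC echar_scale//; apply: eq_echar => //.
by rewrite -[RHS]modzMmr modz_nat zval_mod.
Qed.

Lemma Lambda_zval_rev (p : nat) (I : set nat) (l : rat) :
  (0 < p)%N -> Lambda p I l ->
  exists (b : Zp_dig p) (N : nat), (forall i, b i != ord0 -> I i) /\
    forall n, (N <= n)%N -> l = (zval n (rev_digits n b))%:R / p%:R ^+ n.
Proof.
move=> p_gt0 [b [N [bp [bI ->]]]].
have bE i : (inord (b i) : digit p) = b i :> nat by rewrite inordK// prednK.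
exists (fun i => inord (b i)), N; split=> [i bi|n Nn].
  apply: (bI i _).1; apply: contra_neq bi => bi.
  by apply: val_inj; rewrite /= bE.
rewrite zval_rev// -(subnKC Nn) big_split_ord /=.
rewrite [X in _ + X]big1 ?addr0; first by apply: eq_bigr => i _; rewrite bE.
move=> i _; rewrite bE [b _](_ : _ = 0%N) ?mul0r//; apply/eqP.
by apply: contraT => /bI[_]; rewrite ltnNge leq_addr.
Qed.

Lemma Lambda_neq_digit (p : nat) (I : set nat) (l l' : rat) : (0 < p)%N ->
  Lambda p I l -> Lambda p I l' -> l != l' ->
  exists (n : nat) (y z : Zp_dig p) (j : nat),
    [/\ l = (zval n y)%:R / p%:R ^+ n /\ l' = (zval n z)%:R / p%:R ^+ n,
        (j < n)%N, trunc j y = trunc j z, y j != z j & I (n - j.+1)%N].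
Proof.
move=> p_gt0 Ll Ll' ll'.
have [b [N [bI lE]]] := Lambda_zval_rev p_gt0 Ll.
have [b' [N' [bI' lE']]] := Lambda_zval_rev p_gt0 Ll'.
pose n := maxn N N'; pose y := rev_digits n b; pose z := rev_digits n b'.
have {}lE : l = (zval n y)%:R / p%:R ^+ n := lE n (leq_maxl N N').
have {}lE' : l' = (zval n z)%:R / p%:R ^+ n := lE' n (leq_maxr N N').
have [|j [jn yz yzj]] := @trunc_neq_first p n y z.
  by apply: contra_neq ll' => yz; rewrite lE lE' (zval_trunc yz).
exists n, y, z, j; split=> //.
have [b0|bj] := eqVneq (b (n - j.+1)%N) ord0; last exact: bI.
by apply: bI'; apply: contra_neq yzj; rewrite /y /z /rev_digits b0 => ->.
Qed.

Definition restrict_digits (p : nat) (I : set nat) (x : Zp_dig p) : Zp_dig p :=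
  fun i => if `[< I i >] then x i else ord0.

(* Numerator over [p ^ n] of the sum of the [x i / p ^ i.+1] for [i] in [I],
   [i < n]. *)
Definition freq (p : nat) (I : set nat) (n : nat) (x : Zp_dig p) : nat :=
  zval n (rev_digits n (restrict_digits I x)).

Lemma Lambda_freq (p : nat) (I : set nat) (n : nat) (x : Zp_dig p) :
  (0 < p)%N -> Lambda p I ((freq I n x)%:R / p%:R ^+ n).
Proof.
move=> p_gt0.
exists (fun i => if (i < n)%N then restrict_digits I x i : nat else 0%N), n.
split; first by move=> i; case: ifP => // _; exact: digit_lt.
split; last by rewrite zval_rev//; apply: eq_bigr => i _; rewrite ltn_ord.
by move=> i; case: ifP => // lin; rewrite /restrict_digits; case: asboolP.
Qed.

Section WordSums.
Variables (R : realType) (p : nat).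
Hypothesis p_gt0 : (0 < p)%N.
Implicit Types (x y z : Zp_dig p).

Lemma sum_echar_fill (J : set nat) (phi : forall j, word p j -> digit p)
    n y z j :
  (j < n)%N -> trunc j y = trunc j z -> y j != z j -> ~ J (n - j.+1)%N ->
  \sum_(t : word p n) echar R (p ^ n)
    (((zval n y)%:Z - (zval n z)%:Z) *
     (zval n (fill J phi (untrunc t)))%:Z) = 0.
Proof.
move=> jn yz yzj notJ; have iln : (n - j.+1 < n)%N by lia.
apply: (@sum_echar_bump R p p_gt0 _ (fun t => fill J phi (untrunc t)) _ _ _
  (n - j.+1) _ _ _ (@bump_digit_inj _ _ (Ordinal iln)) _ _ yz yzj).
- by lia.
- move=> t; apply: fill_trunc; apply/trunc_eqP => k kn.
  by rewrite untrunc_bump ltn_eqF.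
- by move=> t; rewrite !fill_notJ// untrunc_bump eqxx.
Qed.

Lemma sum_echar_freq (I : set nat) n y z i :
  (i < n)%N -> trunc i y = trunc i z -> y i != z i -> I i ->
  \sum_(t : word p n) echar R (p ^ n)
    (((zval n y)%:Z - (zval n z)%:Z) * (freq I n (untrunc t))%:Z) = 0.
Proof.
move=> iln yz yzi Ii.
apply: (@sum_echar_bump R p p_gt0 _
  (fun t => rev_digits n (restrict_digits I (untrunc t))) _ _ _ (n - i.+1)
  _ _ _ (@bump_digit_inj _ _ (Ordinal iln)) _ _ yz yzi).
- by lia.
- move=> t; apply/trunc_eqP => k kn; rewrite /rev_digits /restrict_digits.
  have /negbTE ki : (n - k.+1 != i)%N by lia.
  by rewrite untrunc_bump /= ki.
- move=> t; rewrite /rev_digits /restrict_digits.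
  have -> : (n - (n - i.+1).+1 = i)%N by lia.
  by rewrite asboolT// untrunc_bump eqxx.
Qed.

End WordSums.

Section Spectrum.
Variables (R : realType) (p : nat) (I J : set nat).
Variable phi : forall j : nat, word p j -> digit p.
Variable m : probability (Zpadic p) R.
Hypothesis p_prime : prime p.
Hypothesis m_translation : forall (a : Zpadic p) (A : set (Zpadic p)),
  measurable A -> m (zp_add a @` A) = m A.

Let p_gt0 : (0 < p)%N. Proof. exact: prime_gt0. Qed.

Local Notation mu := (distribution m (fill J phi)).

Lemma integral_fill_trunc_eq0 n (G : word p n -> R[i]) :
  \sum_(t : word p n) G (trunc n (fill J phi (untrunc t))) = 0 ->
  (\int[mu]_x (complex.Re (G (trunc n x)))%:E = 0)%E /\
  (\int[mu]_x (complex.Im (G (trunc n x)))%:E = 0)%E.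
Proof.
have integralE := integral_fill_trunc p_gt0 m_translation J phi.
move=> G0; rewrite (integralE _ (fun t => complex.Re (G t))).
by rewrite (integralE _ (fun t => complex.Im (G t))) -Re_sum -Im_sum G0 !mulr0.
Qed.

Lemma phase_orthonormal : I `&` J = set0 -> forall l l' : rat,
  Lambda p I l -> Lambda p I l' ->
  (\int[mu]_x (cos (2 * pi * (phase R l x - phase R l' x)))%:E
    = (if l == l' then 1 else 0)%:E)%E /\
  (\int[mu]_x (sin (2 * pi * (phase R l x - phase R l' x)))%:E = 0)%E.
Proof.
move=> IJ0 l l' Ll Ll'; case: eqVneq => [<-|ll'].
  under eq_integral do rewrite subrr mulr0 cos0.
  under [X in _ /\ X = _]eq_integral do rewrite subrr mulr0 sin0.
  by rewrite !integral_cst//= probability_setT mul1e mul0e.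
have [n [y [z [j [[lE lE'] jn yz yzj Inj]]]]] :=
  Lambda_neq_digit p_gt0 Ll Ll' ll'.
have notJ : ~ J (n - j.+1)%N.
  by move=> Jnj; have : (I `&` J) (n - j.+1)%N by []; rewrite IJ0.
pose G (t : word p n) :=
  echar R (p ^ n) (((zval n y)%:Z - (zval n z)%:Z) * (zval n (untrunc t))%:Z).
have GE x : expi2pi (phase R l x - phase R l' x) = G (trunc n x).
  rewrite expi2piD expi2piN lE lE' !expi2pi_phase// -echarN -echarD /G.
  by rewrite -mulrBl zval_untrunc.
have [|cosE sinE] := @integral_fill_trunc_eq0 n G.
  rewrite -[RHS](sum_echar_fill R p_gt0 phi jn yz yzj notJ).
  by apply: eq_bigr => t _; rewrite /G zval_untrunc.
by split; [rewrite -[RHS]cosE|rewrite -[RHS]sinE];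
  apply: eq_integral => x _; rewrite -GE.
Qed.

Lemma Omega_freq_complete : I `|` J = setT -> forall n (W : word p n -> R[i]),
  (forall t, ~ Omega J phi n (untrunc t) -> W t = 0) ->
  (forall b : Zp_dig p, \sum_t W t *
     (echar R (p ^ n) ((freq I n b)%:Z * (zval n (untrunc t))%:Z))^*%C = 0) ->
  forall s, W s = 0.
Proof.
move=> IJT n W W_supp W_orth s.
have [sO|/W_supp//] := pselect (Omega J phi n (untrunc s)).
pose a (b : word p n) := freq I n (untrunc b).
pose val (t : word p n) := zval n (untrunc t).
have : \sum_(b : word p n) echar R (p ^ n) ((a b)%:Z * (val s)%:Z) *
    \sum_t W t * (echar R (p ^ n) ((a b)%:Z * (val t)%:Z))^*%C = 0.
  by rewrite big1// => b _; rewrite W_orth mulr0.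
have kernel t : \sum_b echar R (p ^ n) ((a b)%:Z * (val s)%:Z) *
    (W t * (echar R (p ^ n) ((a b)%:Z * (val t)%:Z))^*%C) =
    W t * \sum_b echar R (p ^ n) (((val s)%:Z - (val t)%:Z) * (a b)%:Z).
  rewrite mulr_sumr; apply: eq_bigr => b _.
  by rewrite mulrCA -echarN -echarD mulrBl ![_ * (a b)%:Z]mulrC.
have off_diagonal t : t != s ->
    W t * \sum_b echar R (p ^ n) (((val s)%:Z - (val t)%:Z) * (a b)%:Z) = 0.
  have [tO ts|/W_supp->] := pselect (Omega J phi n (untrunc t)); last first.
    by rewrite mul0r.
  have [|i [iln st sti]] := @trunc_neq_first p n (untrunc s) (untrunc t).
    by rewrite !untruncK eq_sym.
  have Ii : I i.
    have [//|Ji] : (I `|` J) i by rewrite IJT.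
    by move: sti; rewrite (Omega_agree p_gt0 iln sO tO st Ji) eqxx.
  by rewrite (sum_echar_freq R p_gt0 iln st sti Ii) mulr0.
under eq_bigr do rewrite mulr_sumr; rewrite exchange_big/=.
under eq_bigr do rewrite kernel.
rewrite (bigD1 s)//= [X in _ + X]big1 ?addr0//.
under eq_bigr do rewrite subrr mul0r echar0.
move/eqP; rewrite sumr_const mulf_eq0 pnatr_eq0 => /orP[/eqP//|/eqP/card0_eq].
by move=> /(_ s).
Qed.

Lemma Rintegral_fiber_notin_Omega (u : Zpadic p -> R) n (t : word p n) :
  mu.-integrable setT (EFin \o u) -> ~ Omega J phi n (untrunc t) ->
  \int[mu]_(x in fiber t) u x = 0.
Proof.
move=> iu tO; rewrite /Rintegral null_set_integral//.
- exact: measurable_fiber.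
- by apply: (measurable_funS measurableT) (measurable_int _ iu).
- by have := fill_law_fiber p_gt0 m_translation J phi t; rewrite asboolF.
Qed.

Lemma phase_complete : I `|` J = setT -> forall u v : Zpadic p -> R,
  mu.-integrable setT (EFin \o u) -> mu.-integrable setT (EFin \o v) ->
  (forall l : rat, Lambda p I l ->
     (\int[mu]_x (u x * cos (2 * pi * phase R l x)
                  + v x * sin (2 * pi * phase R l x))%:E = 0)%E /\
     (\int[mu]_x (v x * cos (2 * pi * phase R l x)
                  - u x * sin (2 * pi * phase R l x))%:E = 0)%E) ->
  {ae mu, forall x, u x = 0 /\ v x = 0}.
Proof.
move=> IJT u v iu iv uv0.
suff uv_fiber n (t : word p n) :
    \int[mu]_(x in fiber t) u x = 0 /\ \int[mu]_(x in fiber t) v x = 0.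
  have u0 := ae_eq0_fiber iu (fun n t => (uv_fiber n t).1).
  have v0 := ae_eq0_fiber iv (fun n t => (uv_fiber n t).2).
  exact: filterS2 u0 v0.
pose w (s : word p n) : R[i] :=
  (\int[mu]_(x in fiber s) u x +i* \int[mu]_(x in fiber s) v x)%C.
suff : w t = 0 by case.
apply: (Omega_freq_complete IJT) => [s sO|b].
  by rewrite /w !Rintegral_fiber_notin_Omega.
pose e (s : word p n) :=
  echar R (p ^ n) ((freq I n b)%:Z * (zval n (untrunc s))%:Z).
have eE x : e (trunc n x) = expi2pi (phase R ((freq I n b)%:R / p%:R ^+ n) x).
  by rewrite expi2pi_phase// /e zval_untrunc.
have [cosE sinE] := uv0 _ (Lambda_freq I n b p_gt0).
rewrite [LHS](sum_preimage_mul_conj (@measurable_fiber p n) e iu iv).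
by congr Complex; rewrite -[RHS]/(fine 0); [rewrite -cosE|rewrite -sinE];
  congr fine; apply: eq_integral => x _; rewrite eE.
Qed.

End Spectrum.

Theorem theorem7p1 (R : realType) (p : nat) (hp : prime p) (I J : set nat)
  (hIJ : I `&` J = set0) (hIJU : I `|` J = setT)
  (hI : infinite_set I) (hJ : infinite_set J)
  (phi : forall j : nat, {ffun 'I_j -> digit p} -> digit p)
  (m : {measure set (Zpadic p) -> \bar R})
  (hm1 : m setT = 1%E)
  (hmT : forall (a : Zpadic p) (A : set (Zpadic p)), measurable A ->
           m (zp_add a @` A) = m A) :
  (forall g : nat, Omega J phi g.+1 `<=` Omega J phi g) /\
  exists mu : probability (Zpadic p) R,
    (forall f : Zpadic p -> R, zp_continuous f ->
       (fun g : nat => fine (\int[m]_(x in Omega J phi g) (f x)%:E)%E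
                       / fine (m (Omega J phi g)))
         @ \oo --> fine (\int[mu]_x (f x)%:E)%E) /\
    (exists A : set (Zpadic p), measurable A /\ m A = 0%E /\ mu (~` A) = 0%E) /\
    (forall l l' : rat, Lambda p I l -> Lambda p I l' ->
       (\int[mu]_x (cos (2 * pi * (phase R l x - phase R l' x)))%:E
         = (if l == l' then 1 else 0)%:E)%E /\
       (\int[mu]_x (sin (2 * pi * (phase R l x - phase R l' x)))%:E = 0)%E) /\
    (forall u v : Zpadic p -> R,
       measurable_fun setT u -> measurable_fun setT v ->
       mu.-integrable setT (fun x => (u x ^+ 2)%:E) ->
       mu.-integrable setT (fun x => (v x ^+ 2)%:E) ->
       (forall l : rat, Lambda p I l ->
          (\int[mu]_x (u x * cos (2 * pi * phase R l x)
                       + v x * sin (2 * pi * phase R l x))%:E = 0)%E /\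
          (\int[mu]_x (v x * cos (2 * pi * phase R l x)
                       - u x * sin (2 * pi * phase R l x))%:E = 0)%E) ->
       {ae mu, forall x, u x = 0 /\ v x = 0}).
Proof.
have p_gt0 := prime_gt0 hp; split=> [g|]; first exact: Omega_le.
have [P mE] := measure_probability hm1; subst m.
exists (distribution P (fill J phi)); split=> [f|].
  exact: fill_law_weak_limit.
split; first exact: fill_law_singular (prime_gt1 hp) hJ.
split; first exact: phase_orthonormal.
move=> u v mfu mfv iu2 iv2; apply: phase_complete => //.
  exact: integrable_sqr_integrable mfu iu2.
exact: integrable_sqr_integrable mfv iv2.
Qed.
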